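(* In the steady state of the discrete-time queue with batch-size-dependent service and single ($\delta_p=0$) or multiple ($\delta_p=1$) vacations described in the context, the arbitrary-slot probabilities $p_{n,0}$, $p_{n,r}$, $Q_n$ and the epoch probabilities $p^+_{n,r}$, $p^+_n$, $Q^+_n$ are related by $$p_{n,0}=\frac{1}{E^*}\sum_{m=0}^{n}Q^+_m,\quad 0\le n\le a-1,$$ $$p_{0,a}=\frac1{E^*}\Big(p^+_a+Q^+_a-p^+_{0,a}+(1-\delta_p)\sum_{m=0}^{a-1}Q^+_m\Big),$$ $$p_{0,r}=\frac1{E^*}\big(p^+_r+Q^+_r-p^+_{0,r}\big),\quad a+1\le r\le b,$$ $$p_{n,r}=p_{n-1,r}-\frac{p^+_{n,r}}{E^*},\quad n\ge1,\ a\le r\le b-1,$$ $$p_{n,b}=p_{n-1,b}+\frac1{E^*}\big(p^+_{n+b}+Q^+_{n+b}-p^+_{n,b}\big),\quad n\ge1,$$ $$Q_0=\frac1{E^*}\big(p^+_0-(1-\delta_p)Q^+_0\big),$$ $$Q_n=Q_{n-1}+\frac1{E^*}\big(p^+_n-(1-\delta_p)Q^+_n\big),\quad 1\le n\le a-1,$$ $$Q_n=Q_{n-1}-\frac{Q^+_n}{E^*},\quad n\ge a,$$ where $$E^*=\lambda\omega+(1-\delta_p)\sum_{i=0}^{a-1}\sum_{m=0}^{i}Q^+_m,$$ $$\omega=\sum_{n=0}^{a-1}\big\{p^+_nE(V)+(1-\delta_p)Q^+_ns_a+\delta_pQ^+_nE(V)\big\}+\sum_{n=a}^{b}(p^+_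n+Q^+_n)s_n+\sum_{n=b+1}^{\infty}(p^+_n+Q^+_n)s_b.$$
   Context: Parameters: integers $1\le a\le b$; $0<\lambda<1$, $\bar\lambda=1-\lambda$ (Bernoulli arrivals, one customer per slot with probability $\lambda$); $\delta_p\in\{0,1\}$ ($0$: single vacation, $1$: multiple vacation). For $a\le r\le b$, the service time of a batch of size $r$ is a random variable on $\{1,2,\dots\}$ with general distribution depending on $r$ and mean $s_r=1/\mu_r$; a vacation has a general distribution on $\{1,2,\dots\}$ with mean $E(V)$. Stability: $\lambda/(b\mu_b)<1$. The waiting room is infinite. Customers are served by a single server in batches by the $(a,b)$ rule: service starts only if at least $a$ customers wait; all are taken if there are between $a$ and $b$, otherwise exactly $b$; arriving customers cannot join an ongoing service. After a service, if at least $a$ wait, the next service starts; if fewer than $a$ wait, the server takes a vacation. If fewer than $a$ wait at the end of a vacation, the server stays dormant until $a$ have accumulated (single vacation) or takes another vacation (multiple vacation); if at least $a$ wait, service starts. The system is late arrival with delayed access: around each slot boundary $k$ a potential arrival occurs in $(k-,k)$ and a potential batch departure in $(k,k+)$, so a customer arriving in the slot in which a service or vacation ends is counted in the queue when the server decides what to do next. Steady-state probabilities at the epochs $k-$: $p_{n,0}$ ($0\le n\le a-1$): server dormant, $n$ in queue; $p_{n,r}(u)$ ($n\ge0$, $a\le r\le b$, $u\ge1$): server busy with a batch of $r$, remaining service time $u$, $n$ in queue; $Q_n(u)$ ($n\ge0$, $u\ge1$): server on vacation with remaining vacation time $u$, $n$ in queue. Here $u=1$ means that the service or vacation ends at the coming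 slot boundary. The arbitrary-slot probabilities are $p_{n,r}=\sum_{u\ge1}p_{n,r}(u)$ for $a\le r\le b$, $Q_n=\sum_{u\ge1}Q_n(u)$, and $p_{n,0}$; the normalization used is $(1-\delta_p)\sum_{n=0}^{a-1}p_{n,0}+\sum_{n\ge0}\sum_{r=a}^bp_{n,r}+\sum_{n\ge0}Q_n=1$. Epoch probabilities: with $\tau=\sum_{m\ge0}\sum_{r=a}^bp_{m,r}(1)+\sum_{m\ge0}Q_m(1)$, set $p^+_{0,r}=\tau^{-1}\bar\lambda p_{0,r}(1)$, $p^+_{n,r}=\tau^{-1}(\bar\lambda p_{n,r}(1)+\lambda p_{n-1,r}(1))$ for $n\ge1$ (service completion of a batch of size $r$ leaving $n$ in queue), $p_n^+=\sum_{r=a}^bp^+_{n,r}$, and $Q_0^+=\tau^{-1}\bar\lambda Q_0(1)$, $Q_n^+=\tau^{-1}(\bar\lambda Q_n(1)+\lambda Q_{n-1}(1))$ for $n\ge1$ (vacation termination with $n$ in queue).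
   Formalization: For multiple vacations (δ_p=1) the server is never dormant, so the first identity fails if p_{n,0} is the dormancy probability; there p_{n,0} is instead a formal solution of the dormancy balance equation. For δ_p=0 it is the dormancy probability. *)

(* Defs.v *)
From HB Require Import structures.
From mathcomp Require Import all_boot all_order all_algebra.
From mathcomp Require Import all_classical all_reals all_analysis.
Set Implicit Arguments.
Unset Strict Implicit.
Unset Printing Implicit Defensive.
Import Order.TTheory GRing.Theory Num.Theory.
Import numFieldNormedType.Exports.
Local Open Scope classical_set_scope.
Local Open Scope ring_scope.

Local Notation "\sum_ ( m <= i '<oo' ) F" :=
  (\big[+%R/0%R]_(m <= i <oo) F%R) : ring_scope.

(* Discrete distributions on {1, 2, ...}, given by their mass function. *)
Definition is_pmf (R : realType) (f : nat -> R) : Prop :=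
  [/\ f 0%N = 0, (forall u, 0 <= f u) & series f @ \oo --> (1 : R)].

Definition has_mean (R : realType) (f : nat -> R) : Prop :=
  cvgn (series (fun u => u%:R * f u)).

Definition mean (R : realType) (f : nat -> R) : R :=
  \sum_(0 <= u <oo) u%:R * f u.

(* [multi] is delta_p: [false] for single, [true] for multiple vacations.
   [serv r] is the mass function of the service time of a batch of size [r],
   [vac] that of a vacation.  The conditions on these data are hypotheses of
   the theorem. *)
Record queue (R : realType) := Queue {
  qa : nat;
  qb : nat;
  lam : R;
  multi : bool;
  serv : nat -> nat -> R;
  vac : nat -> R }.

(* States at the epochs k-, just before the potential arrival: the first
   argument is the number in queue (the batch in service excluded).  In
   [Busy n r u] and [Vacation n u], [u] is the remaining time; [u = 1] means
   that the service or vacation ends at the coming slot boundary. *)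
Inductive state :=
  | Dormant of nat
  | Busy of nat & nat & nat
  | Vacation of nat & nat.

Definition state_code (x : state) : nat + (nat * nat * nat) + (nat * nat) :=
  match x with
  | Dormant n => inl (inl n)
  | Busy n r u => inl (inr (n, r, u))
  | Vacation n u => inr (n, u)
  end.

Definition state_decode (c : nat + (nat * nat * nat) + (nat * nat)) : state :=
  match c with
  | inl (inl n) => Dormant n
  | inl (inr (n, r, u)) => Busy n r u
  | inr (n, u) => Vacation n u
  end.

Lemma state_codeK : cancel state_code state_decode.
Proof. by case. Qed.

HB.instance Definition _ := Countable.copy state (can_type state_codeK).

Section Chain.
Context {R : realType}.
Implicit Types (q : queue R) (x y : state) (pi : state -> R).

(* With multiple vacations the server is never dormant. *)
Definition state_space q : set state := [set x |
  match x with
  | Dormant n => ~~ multi q && (n < qa q)%N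
  | Busy n r u => (qa q <= r <= qb q)%N && (0 < u)%N
  | Vacation n u => (0 < u)%N
  end].

(* Laws of the next state.  Here [n] is the queue length at the slot boundary,
   the arrival of the current slot, if any, included. *)
Definition start_service q (n : nat) y : R :=
  if y is Busy n' r u
  then ((r == minn n (qb q)) && (n' == n - r)%N)%:R * serv q r u else 0.

Definition start_vacation q (n : nat) y : R :=
  if y is Vacation n' u then (n' == n)%:R * vac q u else 0.

Definition after_service q (n : nat) y : R :=
  if (qa q <= n)%N then start_service q n y else start_vacation q n y.

Definition after_dormancy q (n : nat) y : R :=
  if (qa q <= n)%N then start_service q n y else (y == Dormant n)%:R.

Definition after_vacation q (n : nat) y : R :=
  if (qa q <= n)%N then start_service q n y
  else if multi q then start_vacation q n y else (y == Dormant n)%:R.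

Definition next_given q (arrival : bool) x y : R :=
  match x with
  | Dormant n => after_dormancy q (n + arrival) y
  | Busy n r u =>
      if u == 1%N then after_service q (n + arrival) y
      else (y == Busy (n + arrival) r u.-1)%:R
  | Vacation n u =>
      if u == 1%N then after_vacation q (n + arrival) y
      else (y == Vacation (n + arrival) u.-1)%:R
  end.

Definition transition q x y : R :=
  (1 - lam q) * next_given q false x y + lam q * next_given q true x y.

Definition steady_state q pi : Prop :=
  [/\ (forall x, 0 <= pi x),
      (forall x, ~ state_space q x -> pi x = 0),
      \esum_(x in state_space q) (pi x)%:E = 1%E
    & forall y, state_space q y ->
        \esum_(x in state_space q) (pi x * transition q x y)%:E = (pi y)%:E].

Definition delta q : R := (multi q)%:R.

(* [f n] if no customer arrives in the slot, [f (n - 1)] if one does. *)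
Definition arr q (f : nat -> R) (n : nat) : R :=
  (1 - lam q) * f n + (if n is m.+1 then lam q * f m else 0).

(* The numbers p_{n,0}.  Dormancy carries the mass (1 - delta_p) p_{n,0}, as in
   the normalization (1 - delta_p) sum p_{n,0} + ... = 1, so for single
   vacations p_{n,0} is the probability of [Dormant n], and the balance equation
   is an instance of stationarity.  For multiple vacations no state is dormant
   and p_{n,0} is only a formal solution of the same balance equation. *)
Definition dormant_probs q pi (p0 : nat -> R) : Prop :=
  forall n, (n < qa q)%N ->
    pi (Dormant n) = (1 - delta q) * p0 n /\
    p0 n = arr q p0 n + arr q (fun m => pi (Vacation m 1)) n.

(* For a steady state, all the real series below converge. *)

Definition p_busy pi (n r : nat) : R := \sum_(1 <= u <oo) pi (Busy n r u).

Definition p_vac pi (n : nat) : R := \sum_(1 <= u <oo) pi (Vacation n u).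

Definition tau q pi : R :=
  \sum_(0 <= m <oo) \sum_(qa q <= r < (qb q).+1) pi (Busy m r 1)
  + \sum_(0 <= m <oo) pi (Vacation m 1).

Definition pplus_r q pi (n r : nat) : R :=
  (tau q pi)^-1 * arr q (fun m => pi (Busy m r 1)) n.

Definition pplus q pi (n : nat) : R :=
  \sum_(qa q <= r < (qb q).+1) pplus_r q pi n r.

Definition Qplus q pi (n : nat) : R :=
  (tau q pi)^-1 * arr q (fun m => pi (Vacation m 1)) n.

Definition s q (r : nat) : R := mean (serv q r).

Definition mu q (r : nat) : R := (s q r)^-1.

Definition EV q : R := mean (vac q).

Definition omega q pi : R :=
  \sum_(0 <= n < qa q)
     (pplus q pi n * EV q + (1 - delta q) * Qplus q pi n * s q (qa q)
      + delta q * Qplus q pi n * EV q)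
  + \sum_(qa q <= n < (qb q).+1) (pplus q pi n + Qplus q pi n) * s q n
  + \sum_((qb q).+1 <= n <oo) (pplus q pi n + Qplus q pi n) * s q (qb q).

Definition Estar q pi : R :=
  lam q * omega q pi
  + (1 - delta q) * \sum_(0 <= i < qa q) \sum_(0 <= m < i.+1) Qplus q pi m.

End Chain.

(* Main.v *)
(* Every busy (or vacation) state counts down its remaining time, so the
   stationarity equations read f(n,u) = (arrivals applied to f(.,u+1))(n)
   + g(u) B(n), where g is the law of the service (vacation) time and B(n) the
   rate at which such a period is entered with n in queue.  Summing over u gives
   lam (p_n - p_{n-1}) = B(n) - tau p^+_n, and the entry rates are tau times
   epoch probabilities: these are the asserted relations with tau / lam in place
   of 1 / E.  Summing over n as well shows that the mass of such periods
   is (total entry rate) * (mean duration), so that the normalization of pi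
   reads tau E = lam.  The same identity shows tau <> 0: otherwise all entry
   rates, hence all masses, would vanish. *)

Require Import Defs.
From mathcomp Require Import all_boot all_order all_algebra.
From mathcomp Require Import all_classical all_reals all_analysis.
From mathcomp Require Import zify ring lra.
Set Implicit Arguments.
Unset Strict Implicit.
Unset Printing Implicit Defensive.
Import Order.TTheory GRing.Theory Num.Theory.
Import numFieldNormedType.Exports.
Local Open Scope classical_set_scope.
Local Open Scope ring_scope.

(** * Convergent real series *)

(** A relation rather than a value: [limn] of a divergent series is a default value, so each sum
    carries its convergence along. *)
Definition sums_to {R : realType} (f : nat -> R) (l : R) : Prop :=
  series f @ \oo --> l.

Lemma sums_to_unique {R : realType} (f : nat -> R) (l l' : R) :
  sums_to f l -> sums_to f l' -> l = l'.
Proof. by move=> h h'; apply: cvg_unique h h'. Qed.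

Lemma sums_to_ext {R : realType} (f g : nat -> R) (l : R) :
  f =1 g -> sums_to f l -> sums_to g l.
Proof. by move=> /funext ->. Qed.

Lemma sums_toD {R : realType} (f g : nat -> R) (l m : R) :
  sums_to f l -> sums_to g m -> sums_to (fun n => f n + g n) (l + m).
Proof. by move=> hf hg; rewrite /sums_to (seriesD f g); exact: cvgD. Qed.

Lemma sums_toZ {R : realType} (f : nat -> R) (c l : R) :
  sums_to f l -> sums_to (fun n => c * f n) (c * l).
Proof. by move=> hf; rewrite /sums_to (seriesZ f c); exact: cvgMl_tmp. Qed.

Lemma sums_to_shift {R : realType} (f : nat -> R) (l : R) :
  sums_to f l <-> sums_to (fun n => f n.+1) (l - f 0%N).
Proof.
have e n : series (fun n => f n.+1) n = series f n.+1 - f 0%N.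
  by rewrite /series /= [in RHS]big_nat_recl// addrC addKr.
rewrite /sums_to; split => h.
  rewrite (funext e); apply: cvgB; last exact: cvg_cst.
  by move: h; rewrite -cvg_shiftS.
rewrite -cvg_shiftS.
rewrite (_ : [sequence _]_n = fun n => series (fun n => f n.+1) n + f 0%N).
  by rewrite -[l](subrK (f 0%N)); apply: cvgD h _; exact: cvg_cst.
by apply/funext => n; rewrite e subrK.
Qed.

Lemma sums_to_bounds {R : realType} (f : nat -> R) (l : R) n :
  (forall n, 0 <= f n) -> sums_to f l -> 0 <= series f n <= l.
Proof.
move=> f0 h; rewrite sumr_ge0//=.
rewrite -(cvg_lim (@Rhausdorff R) h); apply: nondecreasing_cvgn_le.
  by apply: nondecreasing_series => k _ _; exact: f0.
by apply: cvgP h.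
Qed.

Lemma sums_to_term {R : realType} (f : nat -> R) (l : R) n :
  (forall n, 0 <= f n) -> sums_to f l -> 0 <= f n <= l.
Proof.
move=> f0 h; rewrite f0 /=.
have /andP[_] := sums_to_bounds n.+1 f0 h.
by apply: le_trans; rewrite seriesSr lerDr sumr_ge0.
Qed.

Lemma sums_to_ge0 {R : realType} (f : nat -> R) (l : R) :
  (forall n, 0 <= f n) -> sums_to f l -> 0 <= l.
Proof.
by move=> f0 /(sums_to_term 0 f0)/andP[]; exact: le_trans.
Qed.

Lemma sums_to_eq0 {R : realType} (f : nat -> R) n :
  (forall n, 0 <= f n) -> sums_to f 0 -> f n = 0.
Proof. by move=> f0 /(sums_to_term n f0); rewrite -eq_le => /eqP. Qed.

Lemma sums_to_dominated {R : realType} (f g : nat -> R) (l : R) :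
  (forall n, 0 <= f n <= g n) -> sums_to g l ->
  sums_to f (limn (series f)).
Proof.
move=> fg h; suff : cvgn (series f) by [].
have f0 n : 0 <= f n by have /andP[] := fg n.
apply: (@series_le_cvg _ f g) => //.
- by move=> n; have /andP[] := fg n; exact: le_trans.
- by move=> n; have /andP[] := fg n.
- by apply: cvgP h.
Qed.

Lemma sums_to_finsupp {R : realType} (f : nat -> R) (N : nat) :
  (forall n, (N <= n)%N -> f n = 0) -> sums_to f (\sum_(0 <= n < N) f n).
Proof.
move=> f0; apply: cvg_near_cst; exists N => // n /= Nn.
rewrite /series /= (big_cat_nat (n := N))//= [X in _ + X]big_nat_cond.
by rewrite [X in _ + X]big1 ?addr0// => i /andP[/andP[Ni _] _]; exact: f0.
Qed.

(** Bridge to [p_busy] and [p_vac], which sum from remaining time 1 on, whereas [sums_to] starts at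
    0; the missing terms belong to impossible states. *)
Lemma sums_to_lim {R : realType} (f : nat -> R) (m : nat) (l : R) :
  (forall n, (n < m)%N -> f n = 0) -> sums_to f l ->
  limn (fun n => \sum_(m <= i < n) f i) = l.
Proof.
move=> f0 h; apply: cvg_lim => //; apply: cvg_trans h.
apply: near_eq_cvg; exists m => // n /= mn.
rewrite /series /= (big_cat_nat (n := m))//= big_nat_cond big1 ?add0r//.
by move=> i /andP[/andP[_ im] _]; exact: f0.
Qed.

(** * Unordered extended-real sums against real series *)

Lemma esum_EFin {R : realType} (f : nat -> R) (l : R) :
  (forall n, 0 <= f n) ->
  sums_to f l -> \esum_(n in [set: nat]) (f n)%:E = l%:E.
Proof.
move=> f0 h; rewrite -nneseries_esumT; last by move=> n; rewrite lee_fin.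
apply: cvg_lim => //.
rewrite (_ : (fun _ => _) = EFin \o series f).
  by apply: cvg_EFin => //; exact: nearW.
by apply/funext => n; rewrite /series /= sumEFin.
Qed.

(** The partial sums increase and are bounded by the finite extended sum. This is how the
    normalization of [pi] yields real convergence. *)
Lemma esum_sums_to {R : realType} (f : nat -> R) :
  (forall n, 0 <= f n) -> (\esum_(n in [set: nat]) (f n)%:E < +oo)%E ->
  sums_to f (limn (series f)).
Proof.
move=> f0; rewrite -nneseries_esumT; last by move=> n; rewrite lee_fin.
move=> h; suff : cvgn (series f) by [].
apply: nondecreasing_is_cvgn.
  by apply: nondecreasing_series => k _ _; exact: f0.
exists (fine (\sum_(i <oo) (f i)%:E)%E) => _ [n _ <-].
rewrite -lee_fin fineK; last first.
  by rewrite ge0_fin_numE// nneseries_ge0// => i _ _; rewrite lee_fin.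
rewrite /series /= -sumEFin; apply: nneseries_lim_ge => i _ _.
by rewrite lee_fin.
Qed.

Lemma esum_finsupp {R : realType} (T : choiceType) (s : seq T)
    (F : T -> \bar R) :
  uniq s -> (forall x, (0 <= F x)%E) -> (forall x, x \notin s -> F x = 0%E) ->
  \esum_(x in [set: T]) F x = (\sum_(x <- s) F x)%E.
Proof.
move=> us F0 Fs.
rewrite fsbig_seq// -esum_fset; last by move=> i _; exact: F0.
  rewrite [RHS]esum_mkcond; apply: eq_esum => x _.
  by case: ifPn => //; rewrite mem_setE => /Fs.
exact: finite_seq.
Qed.

Lemma esum_term {R : realType} (T : choiceType) (F : T -> \bar R) x :
  (forall x, (0 <= F x)%E) -> (F x <= \esum_(y in [set: T]) F y)%E.
Proof.
move=> F0; rewrite -(@esum_set1 _ _ x F)// [leLHS]esum_mkcond.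
by apply: le_esum => y _; case: ifP.
Qed.

(** * The arrival operator and sums over states *)

Lemma arr0 {R : realType} (q : queue R) f : arr q f 0 = (1 - lam q) * f 0%N.
Proof. by rewrite /arr addr0. Qed.

Lemma arrS {R : realType} (q : queue R) f n :
  arr q f n.+1 = (1 - lam q) * f n.+1 + lam q * f n.
Proof. by []. Qed.

Lemma arr_ge0 {R : realType} (q : queue R) f n :
  0 < lam q < 1 -> (forall n, 0 <= f n) -> 0 <= arr q f n.
Proof.
move=> /andP[l0 l1] f0; apply: addr_ge0.
  by rewrite mulr_ge0// subr_ge0 ltW.
by case: n => // n; rewrite mulr_ge0// ltW.
Qed.

(** Arrivals only move mass between queue lengths: the weights [1 - lam q] and [lam q] add up to
    1. *)
Lemma sums_to_arr {R : realType} (q : queue R) (f : nat -> R) (l : R) :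
  sums_to f l -> sums_to (arr q f) l.
Proof.
move=> h.
have hs : sums_to (fun n => if n is m.+1 then lam q * f m else 0) (lam q * l).
  by apply/sums_to_shift; rewrite subr0; exact: sums_toZ.
have := sums_toD (sums_toZ (c := 1 - lam q) h) hs.
by rewrite -mulrDl subrK mul1r.
Qed.

Lemma sums_to_arr_row {R : realType} (q : queue R) (f : nat -> nat -> R)
    (p : nat -> R) n :
  (forall m, sums_to (f m) (p m)) ->
  sums_to (fun u => arr q (f^~ u) n) (arr q p n).
Proof.
move=> h; apply: sums_toD; first exact: sums_toZ.
case: n => [|n]; last exact: sums_toZ.
by have := @sums_to_finsupp R (fun=> 0) 0 (fun _ _ => erefl); rewrite big_geq.
Qed.

(** The constructors partition the states, and nonnegative terms may be summed iteratively. The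
    queue length is innermost because an arrival acts on it alone. *)
Lemma esum_state {R : realType} (F : state -> \bar R) :
  (forall x, (0 <= F x)%E) ->
  \esum_(x in [set: state]) F x =
  (\esum_(n in [set: nat]) F (Dormant n)
   + \esum_(r in [set: nat]) \esum_(u in [set: nat]) \esum_(n in [set: nat])
       F (Busy n r u)
   + \esum_(u in [set: nat]) \esum_(n in [set: nat]) F (Vacation n u))%E.
Proof.
move=> F0.
rewrite (esumID [set x | if x is Dormant _ then True else False])//.
rewrite (esumID [set x | if x is Busy _ _ _ then True else False]
  (_ `&` ~` _))//.
rewrite addeA; congr (_ + _ + _)%E.
- rewrite -(esum_image _ Dormant) ; last by move=> ? ? _ _ [].
  congr (esum _ _); apply/seteqP; split => [[n|? ? ?|? ?]//=|_ [n _ <-]//].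
  by move=> _; exists n.
  by case.
  by case.
- rewrite esum_esum; last by move=> *; exact: esum_ge0.
  rewrite (eq_esum (b := fun k => \esum_(n in [set: nat])
     F (Busy n k.1 k.2))%E) //.
  rewrite esum_esum//.
  rewrite -(esum_image _ (fun k : nat * nat * nat => Busy k.2 k.1.1 k.1.2) F);
    last by move=> [[? ?] ?] [[? ?] ?] _ _ [-> -> ->].
  congr (esum _ _); apply/seteqP; split => [[n|n r u|? ?]//=|_ [n _ <-]//].
  + by case=> -[].
  + by move=> _; exists (r, u, n).
  + by case.
  + by split => //; split => // -[].
- rewrite esum_esum//.
  rewrite -(esum_image _ (fun k : nat * nat => Vacation k.2 k.1) F);
    last by move=> [? ?] [? ?] _ _ [-> ->].
  congr (esum _ _); apply/seteqP; split => [[n|n r u|n u]//=|_ [n _ <-]//].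
  + by case=> -[].
  + by case=> _ [].
  + by move=> _; exists (u, n).
  + by split => //; split => // -[].
Qed.

(** Probability that a queue of [n] has length [N] at the slot boundary. The sums with [false] and
    [true] mirror [next_given], so that an unfolded [transition] matches. *)
Definition arrival_kernel {R : realType} (q : queue R) (n N : nat) : R :=
  (1 - lam q) * (n + false == N)%N%:R + lam q * (n + true == N)%N%:R.

Lemma arrival_kernelE {R : realType} (q : queue R) n N :
  arrival_kernel q n N =
  (1 - lam q) * (n == N)%:R + lam q * (n.+1 == N)%:R.
Proof. by rewrite /arrival_kernel /= addn0 addn1. Qed.

Lemma arrival_kernel_ge0 {R : realType} (q : queue R) n N :
  0 < lam q < 1 -> 0 <= arrival_kernel q n N.
Proof.
by move=> /andP[l0 l1]; rewrite addr_ge0// mulr_ge0// ?subr_ge0 ltW.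
Qed.

Lemma esum_arrival {R : realType} (q : queue R) (f : nat -> R) (N : nat) :
  0 < lam q < 1 -> (forall n, 0 <= f n) ->
  \esum_(n in [set: nat]) (f n * arrival_kernel q n N)%:E = (arr q f N)%:E.
Proof.
move=> l01 f0; apply: esum_EFin.
  by move=> n; rewrite mulr_ge0// arrival_kernel_ge0.
suff <- : \sum_(0 <= n < N.+1) f n * arrival_kernel q n N = arr q f N.
  apply: sums_to_finsupp => n Nn.
  rewrite arrival_kernelE !gtn_eqF ?(leqW Nn)//.
  by rewrite !mulr0 addr0 mulr0.
rewrite /arr big_nat_recr//= addrC [in X in X + _]arrival_kernelE eqxx.
rewrite gtn_eqF// mulr0 addr0 mulr1 mulrC; congr (_ + _).
case: N => [|N]; first by rewrite big_geq.
rewrite big_nat_recr//= big_nat_cond big1 => [|i /andP[/andP[_ iN] _]].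
  by rewrite add0r arrival_kernelE eqxx ltn_eqF// mulr0 add0r mulr1 mulrC.
rewrite arrival_kernelE !ltn_eqF ?(leqW iN)//.
by rewrite !mulr0 addr0 mulr0.
Qed.

(** * Balance of a period with a remaining-time clock *)

(* [P u] is [beta] times the tail of [g] from [u] on.  The boundary term
   [n * P n.+1] of the Abel summation vanishes because it is at most [beta]
   times the tail of the series defining the mean. *)
Lemma tail_sum {R : realType} (P g : nat -> R) (beta m MP : R) :
  (forall u, 0 <= P u) -> (forall u, 0 <= g u) -> P 0%N = 0 -> g 0%N = 0 ->
  (forall u, P u.+1 = P u.+2 + g u.+1 * beta) ->
  sums_to P MP -> sums_to g 1 -> sums_to (fun u => u%:R * g u) m ->
  MP = beta * m.
Proof.
move=> P_ge0 g_ge0 P0 g0 rec hP hg hm.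
have tele n : P 1%N = P n.+1 + beta * series g n.+1.
  elim: n => [|n IH]; first by
    rewrite seriesSr /series /= big_geq// add0r g0 mulr0 addr0.
  by rewrite IH rec (seriesSr _ n.+1); ring.
have P_to0 : P n.+1 @[n --> \oo] --> (0 : R).
  by rewrite cvg_shiftS; apply: cvg_series_cvg_0; apply: cvgP hP.
have hgS : series g n.+1 @[n --> \oo] --> (1 : R) by rewrite cvg_shiftS.
(* Limit of [tele]: [P] tends to 0, being the term of a convergent series, and [g] has mass 1. *)
have P1 : P 1%N = beta.
  have h : (fun n => P n.+1 + beta * series g n.+1) @ \oo --> 0 + beta * 1.
    by apply: cvgD => //; exact: cvgMl_tmp.
  rewrite add0r mulr1 in h; apply: cvg_unique h => //.
  by rewrite -(funext tele); exact: cvg_cst.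
have beta0 : 0 <= beta by rewrite -P1.
pose M := series (fun u => u%:R * g u).
have abel n : series P n.+1 = beta * M n.+1 + n%:R * P n.+1.
  elim: n => [|n IH].
    by rewrite /M !seriesSr /series /= !big_geq// P0; ring.
  by rewrite seriesSr IH /M (seriesSr _ n.+1) rec -natr1; ring.
have tail n : n%:R * (1 - series g n.+1) <= m - M n.+1.
  have hl : (fun W => n%:R * (series g W - series g n.+1)) @ \oo -->
      n%:R * (1 - series g n.+1).
    by apply: cvgMl_tmp; apply: cvgB => //; exact: cvg_cst.
  have hr : (fun W => M W - M n.+1) @ \oo --> m - M n.+1.
    by apply: cvgB => //; exact: cvg_cst.
  apply: (ler_cvg_to hl hr); exists n.+1 => // W /= nW.
  rewrite !sub_series_geq// mulr_sumr; apply: ler_sum_nat => i /andP[ni _].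
  by rewrite ler_wpM2r// ler_nat ltnW.
have h0 : (fun n => n%:R * P n.+1) @ \oo --> (0 : R).
  have hM : (fun n => beta * (m - M n.+1)) @ \oo --> (0 : R).
    rewrite -[X in _ --> X](mulr0 beta) -(subrr m).
    apply: cvgMl_tmp; apply: cvgB; first exact: cvg_cst.
    by have := hm; rewrite /sums_to -cvg_shiftS.
  apply: (squeeze_cvgr _ (cvg_cst 0) hM); apply: nearW => n.
  rewrite mulr_ge0//= (_ : P n.+1 = beta * (1 - series g n.+1)); last first.
    by have := tele n; rewrite P1; lra.
  by rewrite mulrCA ler_wpM2l.
have : series P n.+1 @[n --> \oo] --> MP by rewrite cvg_shiftS.
move=> h; apply: (cvg_unique _ h) => //; rewrite (funext abel).
rewrite -[beta * m]addr0; apply: cvgD => //; apply: cvgMl_tmp.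
by have := hm; rewrite /sums_to -cvg_shiftS.
Qed.

(* [f n u] is a busy or vacation state with remaining time [u], [B] the entry
   rates and [g] the law of the initial remaining time.  Summing over [u] gives
   the third conclusion, summing over both indices the last one, which is
   Little's law: mass = total entry rate * mean duration. *)
Lemma flow_balance {R : realType} (q : queue R) (f : nat -> nat -> R)
    (g B : nat -> R) :
  0 < lam q < 1 -> (forall n u, 0 <= f n u) -> (forall n, f n 0 = 0) ->
  is_pmf g -> has_mean g -> (forall n, 0 <= B n) ->
  (forall n u, f n u.+1 = arr q (fun m => f m u.+2) n + g u.+1 * B n) ->
  (\esum_(u in [set: nat]) \esum_(n in [set: nat]) (f n u)%:E < +oo)%E ->
  exists p : nat -> R, exists beta : R,
  [/\ forall n, sums_to (f n) (p n),
      forall u, exists P, sums_to (f^~ u) P,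
      forall n, p n = arr q p n - arr q (f^~ 1) n + B n,
      sums_to B beta &
      \esum_(u in [set: nat]) \esum_(n in [set: nat]) (f n u)%:E =
      (beta * mean g)%:E].
Proof.
move=> l01 f_ge0 f0 [g0 g_ge0 g1] gm B_ge0 rec fin.
have inner_ge0 u : (0 <= \esum_(n in [set: nat]) (f n u)%:E)%E.
  by apply: esum_ge0 => n _; rewrite lee_fin.
pose P u := limn (series (f^~ u)).
have hP u : sums_to (f^~ u) (P u).
  apply: esum_sums_to => //; apply: le_lt_trans fin.
  exact: (esum_term (F := fun u => \esum_(n in [set: nat]) (f n u)%:E)%E).
have P_ge0 u : 0 <= P u by apply: sums_to_ge0 (hP u).
have eP : (fun u => \esum_(n in [set: nat]) (f n u)%:E)%E = EFin \o P.
  by apply/funext => u; apply: esum_EFin.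
rewrite eP in fin *.
have hMP := esum_sums_to P_ge0 fin.
set MP := limn _ in hMP.
pose p n := limn (series (f n)).
have hp n : sums_to (f n) (p n).
  apply: (sums_to_dominated (g := P) _ hMP) => // u.
  exact: sums_to_term (hP u).
(* Summing [rec] over [u], the left side omits only the zero term at 0, while the shift by two on
   the right also omits remaining time 1. *)
have balance n : p n = arr q p n - arr q (f^~ 1) n + B n.
  have hS m := (sums_to_shift _ _).1 (hp m).
  have hSS m := (sums_to_shift _ _).1 (hS m).
  have h1 := sums_to_arr_row (q := q) (n := n) hSS.
  have h2 := sums_toZ (c := B n) ((sums_to_shift _ _).1 g1).
  have e : forall u, arr q (fun m => f m u.+2) n + B n * g u.+1 = f n u.+1.
    by move=> u; rewrite rec mulrC.
  have := sums_to_ext e (sums_toD h1 h2).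
  move=> /(sums_to_unique (hS n)).
  rewrite f0 g0 !subr0 mulr1 => ->; congr (_ + _).
  by rewrite /arr; case: (n) => [|k]; rewrite !f0; ring.
(* A duration of positive probability bounds the entry rates: [rec] gives
   [g u0.+1 * B n <= f n u0.+1], which is summable over [n]. *)
have [u0 gu0] : exists u, 0 < g u.+1.
  apply: contrapT => /forallNP h.
  have gE u : g u = 0.
    case: u => // u; apply/eqP; rewrite eq_le g_ge0 andbT leNgt.
    exact/negP/h.
  have := @sums_to_finsupp R g 0 (fun n _ => gE n).
  rewrite big_geq// => /(sums_to_unique g1)/eqP.
  by rewrite oner_eq0.
have [beta hbeta] : exists beta, sums_to B beta.
  eexists; apply: (sums_to_dominated (g := fun n => (g u0.+1)^-1 * f n u0.+1)).
    move=> n; rewrite B_ge0 /= rec mulrDr mulKf ?gt_eqF// lerDr.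
    by rewrite mulr_ge0 ?arr_ge0// invr_ge0 ltW.
  exact: sums_toZ (hP _).
exists p, beta; split => //.
  by move=> u; exists (P u).
rewrite (esum_EFin P_ge0 hMP); congr EFin.
apply: (tail_sum (P := P) (g := g)) => //.
- have := @sums_to_finsupp R (f^~ 0%N) 0 (fun n _ => f0 n).
  by rewrite big_geq// => /(sums_to_unique (hP 0%N)).
- move=> u; apply: sums_to_unique (hP _) _.
  apply: sums_to_ext; last exact: sums_toD
    (sums_to_arr q (hP u.+2)) (sums_toZ (c := g u.+1) hbeta).
  by move=> n /=; rewrite rec.
Qed.

(** * Stationarity written out for busy and vacation states *)

Lemma arrM {R : realType} (q : queue R) f w n :
  arr q (fun m => f m * w) n = arr q f n * w.
Proof. by rewrite /arr; case: n => [|n]; ring. Qed.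

Lemma esum_arrivalM {R : realType} (q : queue R) (f : nat -> R) (w : R) N :
  0 < lam q < 1 -> (forall n, 0 <= f n) -> 0 <= w ->
  \esum_(n in [set: nat]) (f n * (arrival_kernel q n N * w))%:E =
  (arr q f N * w)%:E.
Proof.
move=> l01 f0 w0; rewrite -arrM -esum_arrival//.
  by apply: eq_esum => n _; congr EFin; ring.
by move=> n; rewrite mulr_ge0.
Qed.

(** This and [vacation_end] are the epoch probabilities before division by [tau], hence meaningful
    before [tau] is known to be nonzero. *)
Definition service_end {R : realType} (q : queue R) (pi : state -> R) N : R :=
  \sum_(qa q <= r < (qb q).+1) arr q (fun m => pi (Busy m r 1)) N.

Definition vacation_end {R : realType} (q : queue R) (pi : state -> R) N : R :=
  arr q (fun m => pi (Vacation m 1)) N.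

Definition dormancy_next {R : realType} (q : queue R) (pi : state -> R) N : R :=
  arr q (fun m => pi (Dormant m)) N.

Lemma esum_state_space {R : realType} (q : queue R) (F : state -> R) :
  (forall x, ~ state_space q x -> F x = 0) ->
  \esum_(x in state_space q) (F x)%:E = \esum_(x in [set: state]) (F x)%:E.
Proof.
move=> F0; rewrite esum_mkcond; apply: eq_esum => x _.
by case: ifPn => // xS; rewrite F0// => /mem_set; apply/negP.
Qed.

(* Which states follow an event (end of a service, end of a vacation, slot in
   dormancy) depends only on the queue length at the boundary, and [y] requires
   this length to be [N]; [bB] and [bV] collect the flows from the states that
   only count down. *)
Lemma stationary_sum {R : realType} (q : queue R) (pi : state -> R)
    (y : state) (N u0 : nat) (wS wV wD : R) (bB : nat -> R) (bV : R) :
  0 < lam q < 1 -> steady_state q pi -> state_space q y -> (0 < u0)%N ->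
  0 <= wS -> 0 <= wV -> 0 <= wD ->
  (forall n, after_service q n y = (n == N)%:R * wS) ->
  (forall n, after_vacation q n y = (n == N)%:R * wV) ->
  (forall n, after_dormancy q n y = (n == N)%:R * wD) ->
  (forall r u, (1 < u)%N ->
     \esum_(n in [set: nat])
       (pi (Busy n r u) * transition q (Busy n r u) y)%:E =
     ((u == u0.+1)%:R * bB r)%:E) ->
  (forall u, (1 < u)%N ->
     \esum_(n in [set: nat])
       (pi (Vacation n u) * transition q (Vacation n u) y)%:E =
     ((u == u0.+1)%:R * bV)%:E) ->
  pi y = dormancy_next q pi N * wD
       + (service_end q pi N * wS + \sum_(qa q <= r < (qb q).+1) bB r)
       + (vacation_end q pi N * wV + bV).
Proof.
move=> l01 st yS u0_gt0 wS0 wV0 wD0 hS hV hD hB hVu.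
have [pi0 piout pitot pist] := st.
have next_ge0 b x : 0 <= next_given q b x y.
  case: x => [n|n r u|n u] /=; first by rewrite hD mulr_ge0.
    by case: ifP => _; rewrite ?hS ?mulr_ge0.
  by case: ifP => _; rewrite ?hV ?mulr_ge0.
have tr_ge0 x : 0 <= transition q x y.
  have /andP[l0 l1] := l01.
  by rewrite addr_ge0// mulr_ge0// ?subr_ge0 ltW.
have F0 x : (0 <= (pi x * transition q x y)%:E)%E by rewrite lee_fin mulr_ge0.
apply: EFin_inj; rewrite -pist// esum_state_space; last first.
  by move=> x /piout ->; rewrite mul0r.
rewrite esum_state// !EFinD; congr (_ + _ + _)%E.
- rewrite -esum_arrivalM//; apply: eq_esum => n _.
  by rewrite /transition /= !hD /arrival_kernel; congr EFin; ring.
- rewrite -EFinD /service_end mulr_suml -big_split /=.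
  rewrite (esum_finsupp (s := index_iota (qa q) (qb q).+1)).
  + rewrite -sumEFin; apply: eq_big_nat => r rab.
    (* Only two remaining times contribute: 1, where the service ends, and [u0.+1], which counts
       down to [u0]. Time 0 lies outside the state space. *)
    rewrite (esum_finsupp (s := [:: 1%N; u0.+1])).
    * rewrite !big_cons big_nil adde0 EFinD; congr (_ + _)%E.
        rewrite -esum_arrivalM//; apply: eq_esum => n _.
        by rewrite /transition /= !hS /arrival_kernel; congr EFin; ring.
      by rewrite hB// eqxx mul1r.
    * by rewrite /= inE eqSS andbT eq_sym -lt0n.
    * by move=> u; apply: esum_ge0.
    * move=> u; rewrite !inE negb_or => /andP[u1 uu].
      case: u u1 uu => [_ _|[//|u] _ uu].
        by rewrite esum1// => n _; rewrite piout ?mul0r//= ?ltnn ?andbF.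
      by rewrite hB// (negbTE uu) mul0r.
  + exact: iota_uniq.
  + by move=> r; apply: esum_ge0 => u _; apply: esum_ge0.
  + move=> r; rewrite mem_index_iota ltnS => /negP rab.
    rewrite esum1// => u _; rewrite esum1// => n _.
    by rewrite piout ?mul0r// => /andP[].
- rewrite -EFinD (esum_finsupp (s := [:: 1%N; u0.+1])).
  * rewrite !big_cons big_nil adde0 EFinD; congr (_ + _)%E.
        rewrite -esum_arrivalM//; apply: eq_esum => n _.
        by rewrite /transition /= !hV /arrival_kernel; congr EFin; ring.
      by rewrite hVu// eqxx mul1r.
  * by rewrite /= inE eqSS andbT eq_sym -lt0n.
  * by move=> u; apply: esum_ge0.
  * move=> u; rewrite !inE negb_or => /andP[u1 uu].
      case: u u1 uu => [_ _|[//|u] _ uu].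
        by rewrite esum1// => n _; rewrite piout ?mul0r//= ?ltnn ?andbF.
      by rewrite hVu// (negbTE uu) mul0r.
Qed.

Lemma start_service_busy {R : realType} (q : queue R) n r u N :
  (qa q <= r <= qb q)%N ->
  start_service q N (Busy n r u) =
  (N == n + r)%:R * ((r == minn (n + r) (qb q))%:R * serv q r u).
Proof.
(* The minimum forces [r <= N], so the truncated [N - r] is exact and [n] left over means
   [N = n + r]. *)
move=> rab /=; rewrite mulrA -natrM mulnb; congr (_%:R * _).
by congr nat_of_bool; apply/idP/idP; lia.
Qed.

Lemma add_neq_below a b n r N :
  (a <= r <= b)%N -> (N < a)%N -> (N == n + r)%N = false.
Proof. by move=> rab Na; apply/eqP; lia. Qed.

(** Once at least [qa q] customers wait, a service starts in the same way after a service, a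
    vacation or dormancy, so the three events share one weight [w]. Since [n + r] is at least
    [qa q], the other branches never contribute. *)
Lemma busy_balance {R : realType} (q : queue R) (pi : state -> R) n r u :
  0 < lam q < 1 -> steady_state q pi -> (qa q <= r <= qb q)%N ->
  0 <= serv q r u.+1 ->
  pi (Busy n r u.+1) = arr q (fun m => pi (Busy m r u.+2)) n
    + serv q r u.+1 * ((r == minn (n + r) (qb q))%:R *
       (service_end q pi (n + r) + vacation_end q pi (n + r)
        + dormancy_next q pi (n + r))).
Proof.
move=> l01 st rab g0.
have [pi0 _ _ _] := st.
pose w := (r == minn (n + r) (qb q))%:R * serv q r u.+1.
have w0 : 0 <= w by rewrite mulr_ge0.
rewrite (@stationary_sum _ q pi _ (n + r) u.+1 w w w
  (fun r' => (r' == r)%:R * arr q (fun m => pi (Busy m r u.+2)) n) 0)//.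
- rewrite -mulr_suml.
  have -> : \sum_(qa q <= i < (qb q).+1) (i == r)%:R = 1 :> R.
    rewrite (bigD1_seq r) ?mem_index_iota ?iota_uniq//= eqxx big1 ?addr0//.
    by move=> i /negbTE ->.
  by rewrite /w; ring.
- by rewrite /= rab.
- move=> N; rewrite /after_service; case: leqP => aN.
    by rewrite start_service_busy.
  by rewrite /= (add_neq_below _ rab)// mul0r.
- move=> N; rewrite /after_vacation; case: leqP => aN.
    by rewrite start_service_busy.
  by rewrite (add_neq_below _ rab)// mul0r; case: ifP.
- move=> N; rewrite /after_dormancy; case: leqP => aN.
    by rewrite start_service_busy.
  by rewrite (add_neq_below _ rab)// mul0r.
- move=> r' u' u'1.
  case: (eqVneq u' u.+2) => [->|uu]; last first.
    rewrite mul0r esum1// => m _; rewrite /transition /= gtn_eqF//.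
    have e b : (Busy n r u.+1 == Busy (m + b) r' u'.-1) = false.
      apply/eqP => -[_ _ uE]; move/eqP: uu; apply.
      by move: u'1 uE; lia.
    by rewrite !e !mulr0 addr0 mulr0.
  rewrite mul1r; case: (eqVneq r' r) => [->|rr]; last first.
    rewrite mul0r esum1// => m _; rewrite /transition /=.
    have e b : (Busy n r u.+1 == Busy (m + b) r' u.+1) = false.
      by apply/eqP => -[_ rE]; rewrite rE eqxx in rr.
    by rewrite !e !mulr0 addr0 mulr0.
  rewrite mul1r -esum_arrival//; apply: eq_esum => m _.
  rewrite /transition /= /arrival_kernel.
  have e b : (Busy n r u.+1 == Busy (m + b) r u.+1) = (m + b == n)%N.
    by apply/eqP/eqP => [[->]|<-].
  by rewrite !e.
- move=> u' u'1; rewrite mulr0 esum1// => m _.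
  by rewrite /transition /= gtn_eqF//= !mulr0 addr0 mulr0.
Qed.

(** A short queue sends the server on vacation after a service always, after a vacation only in the
    multiple case, and after dormancy never: hence the weights [w], [delta q * w] and 0. *)
Lemma vacation_balance {R : realType} (q : queue R) (pi : state -> R) n u :
  0 < lam q < 1 -> steady_state q pi -> 0 <= vac q u.+1 ->
  pi (Vacation n u.+1) = arr q (fun m => pi (Vacation m u.+2)) n
    + vac q u.+1 * ((n < qa q)%:R *
       (service_end q pi n + delta q * vacation_end q pi n)).
Proof.
move=> l01 st g0.
have [pi0 _ _ _] := st.
pose w := (n < qa q)%:R * vac q u.+1.
have w0 : 0 <= w by rewrite mulr_ge0.
rewrite (@stationary_sum _ q pi _ n u.+1 w (delta q * w) 0
  (fun _ => 0) (arr q (fun m => pi (Vacation m u.+2)) n))//.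
- by rewrite big1// /w; ring.
- by rewrite mulr_ge0// /delta.
- move=> N; rewrite /after_service /= /w eq_sym.
  case: (eqVneq N n) => [->|_]; rewrite ?mul0r ?mul1r ?if_same//.
  by case: (leqP (qa q) n) => _; rewrite ?mul0r ?mul1r.
- move=> N; rewrite /after_vacation /= /w /delta eq_sym.
  case: (eqVneq N n) => [->|_]; last first.
    by rewrite !mul0r; case: ifP => // _; case: ifP.
  by case: (leqP (qa q) n) => _; case: (multi q); rewrite ?mul0r ?mul1r ?mulr0.
- move=> N; rewrite /after_dormancy mulr0; by case: ifP.
- move=> r' u' u'1; rewrite mulr0 esum1// => m _.
  by rewrite /transition /= gtn_eqF//= !mulr0 addr0 mulr0.
- move=> u' u'1.
  case: (eqVneq u' u.+2) => [->|uu]; last first.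
    rewrite mul0r esum1// => m _; rewrite /transition /= gtn_eqF//.
    have e b : (Vacation n u.+1 == Vacation (m + b) u'.-1) = false.
      apply/eqP => -[_ uE]; move/eqP: uu; apply.
      by move: u'1 uE; lia.
    by rewrite !e !mulr0 addr0 mulr0.
  rewrite mul1r -esum_arrival//; apply: eq_esum => m _.
  rewrite /transition /= /arrival_kernel.
  have e b : (Vacation n u.+1 == Vacation (m + b) u.+1) = (m + b == n)%N.
    by apply/eqP/eqP => [[->]|<-].
  by rewrite !e.
Qed.

(** * Splitting the total mass *)

Lemma sums_to_sum {R : realType} (I : Type) (s : seq I) (f : I -> nat -> R)
    (l : I -> R) :
  (forall i, sums_to (f i) (l i)) ->
  sums_to (fun n => \sum_(i <- s) f i n) (\sum_(i <- s) l i).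
Proof.
move=> h; elim: s => [|i s IH].
  rewrite big_nil; have := @sums_to_finsupp R (fun=> 0) 0 (fun _ _ => erefl).
  by rewrite big_geq//; apply: sums_to_ext => n; rewrite big_nil.
rewrite big_cons; apply: sums_to_ext (sums_toD (h i) IH) => n.
by rewrite big_cons.
Qed.

Lemma sums_to_shiftn {R : realType} (f : nat -> R) (k : nat) (l : R) :
  sums_to f l ->
  sums_to (fun n => f (n + k)%N) (limn (fun n => \sum_(k <= i < n) f i)).
Proof.
move=> h.
have hc : cvgn (fun n => \sum_(k <= i < n) f i).
  by rewrite is_cvg_series_restrict; apply: cvgP h.
rewrite /sums_to (_ : series _ = fun n => \sum_(k <= i < n + k) f i).
  by move: hc; rewrite -(cvg_shiftn k).
apply/funext => n; rewrite /series /= -[in RHS](add0n k) big_addn addnK.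
by [].
Qed.

(** Nonnegative parts of a total of 1 are finite, which is the finiteness that [flow_balance] asks
    for. *)
Lemma mass_decomposition {R : realType} (q : queue R) (pi : state -> R) :
  steady_state q pi ->
  [/\ sums_to (fun n => pi (Dormant n)) (\sum_(0 <= n < qa q) pi (Dormant n)),
      forall r, (\esum_(u in [set: nat]) \esum_(n in [set: nat])
         (pi (Busy n r u))%:E < +oo)%E,
      (\esum_(u in [set: nat]) \esum_(n in [set: nat])
         (pi (Vacation n u))%:E < +oo)%E &
      (1%:E = (\sum_(0 <= n < qa q) pi (Dormant n))%:E
         + \sum_(qa q <= r < (qb q).+1) \esum_(u in [set: nat])
             \esum_(n in [set: nat]) (pi (Busy n r u))%:E
         + \esum_(u in [set: nat]) \esum_(n in [set: nat])
             (pi (Vacation n u))%:E)%E].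
Proof.
move=> [pi0 piout pitot pist].
have F0 x : (0 <= (pi x)%:E)%E by rewrite lee_fin.
have hD : sums_to (fun n => pi (Dormant n))
    (\sum_(0 <= n < qa q) pi (Dormant n)).
  apply: sums_to_finsupp => n an; apply: piout => /= /andP[_].
  by rewrite ltnNge an.
move: pitot; rewrite esum_state_space// esum_state//.
rewrite (esum_EFin (f := fun n => pi (Dormant n)) (fun n => pi0 _) hD).
set eB := (fun r => \esum_(u in [set: nat]) \esum_(n in [set: nat])
  (pi (Busy n r u))%:E)%E.
set eV := (\esum_(u in [set: nat]) \esum_(n in [set: nat])
  (pi (Vacation n u))%:E)%E.
have eB0 r : (0 <= eB r)%E by apply: esum_ge0 => u _; apply: esum_ge0.
have eV0 : (0 <= eV)%E by apply: esum_ge0 => u _; apply: esum_ge0.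
have sD0 : (0 <= (\sum_(0 <= n < qa q) pi (Dormant n))%:E)%E.
  by rewrite lee_fin sumr_ge0.
move=> tot; split => //.
- move=> r; apply: (@le_lt_trans _ _ 1%E); last exact: ltry.
  apply: le_trans (esum_term r eB0) _; rewrite -tot -addeAC.
  by rewrite leeDr// adde_ge0.
- apply: (@le_lt_trans _ _ 1%E); last exact: ltry.
  by rewrite -tot leeDr// adde_ge0//; apply: esum_ge0 => r _; exact: eB0.
- transitivity (1%E : \bar R) => //; rewrite -tot; congr (_ + _ + _)%E.
  apply: esum_finsupp => //; first exact: iota_uniq.
  move=> r; rewrite mem_index_iota ltnS => /negP rab.
  rewrite /eB esum1// => u _; rewrite esum1// => n _.
  by rewrite piout// => /andP[].
Qed.

(** * Entry rates and the mass of each kind of period *)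

(** Rate at which services of a batch of [r] start leaving [n] behind. For [r <= qb q] the indicator
    holds exactly if [n = 0] or [r = qb q]: customers are left only by a full batch. *)
Definition busy_entry {R : realType} (q : queue R) (pi : state -> R) r n : R :=
  (r == minn (n + r) (qb q))%:R *
  (service_end q pi (n + r) + vacation_end q pi (n + r)
   + dormancy_next q pi (n + r)).

Definition vacation_entry {R : realType} (q : queue R) (pi : state -> R)
    n : R :=
  (n < qa q)%:R * (service_end q pi n + delta q * vacation_end q pi n).

Section SteadyState.
Context {R : realType} (q : queue R) (pi : state -> R).
Hypothesis lam01 : 0 < lam q < 1.
Hypothesis steady : steady_state q pi.

Let pi_ge0 x : 0 <= pi x. Proof. by have [] := steady. Qed.

Lemma service_end_ge0 n : 0 <= service_end q pi n.
Proof. by apply: sumr_ge0 => r _; apply: arr_ge0. Qed.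

Lemma vacation_end_ge0 n : 0 <= vacation_end q pi n.
Proof. exact: arr_ge0. Qed.

Lemma dormancy_next_ge0 n : 0 <= dormancy_next q pi n.
Proof. exact: arr_ge0. Qed.

Lemma busy_flow r : (qa q <= r <= qb q)%N ->
  is_pmf (serv q r) -> has_mean (serv q r) ->
  exists beta : R,
  [/\ exists P, sums_to (fun n => pi (Busy n r 1)) P,
      forall n, p_busy pi n r = arr q (p_busy pi ^~ r) n
        - arr q (fun m => pi (Busy m r 1)) n + busy_entry q pi r n,
      sums_to (busy_entry q pi r) beta &
      \esum_(u in [set: nat]) \esum_(n in [set: nat]) (pi (Busy n r u))%:E =
      (beta * s q r)%:E].
Proof.
move=> rab gpmf gmean; have [_ fin _ _] := mass_decomposition steady.
have [_ piout _ _] := steady.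
have g_ge0 u : 0 <= serv q r u by case: gpmf.
have B_ge0 n : 0 <= busy_entry q pi r n.
  apply: mulr_ge0 => //; apply: addr_ge0; last exact: dormancy_next_ge0.
  by apply: addr_ge0; [exact: service_end_ge0|exact: vacation_end_ge0].
have f0 n : pi (Busy n r 0) = 0 by apply: piout => /andP[].
have rec n u := busy_balance n lam01 steady rab (g_ge0 u.+1).
have [p [beta [hp hP bal hb e]]] := flow_balance lam01
  (fun n u => pi_ge0 (Busy n r u)) f0 gpmf gmean B_ge0 rec (fin r).
exists beta; split => //.
have pE n : p_busy pi n r = p n.
  by apply: (sums_to_lim _ (hp n)); case.
by move=> n; rewrite pE bal (funext pE).
Qed.

Lemma vacation_flow : is_pmf (vac q) -> has_mean (vac q) ->
  exists gamma : R,
  [/\ exists P, sums_to (fun n => pi (Vacation n 1)) P,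
      forall n, p_vac pi n = arr q (p_vac pi) n
        - arr q (fun m => pi (Vacation m 1)) n + vacation_entry q pi n,
      sums_to (vacation_entry q pi) gamma &
      \esum_(u in [set: nat]) \esum_(n in [set: nat]) (pi (Vacation n u))%:E =
      (gamma * EV q)%:E].
Proof.
move=> gpmf gmean; have [_ _ fin _] := mass_decomposition steady.
have [_ piout _ _] := steady.
have g_ge0 u : 0 <= vac q u by case: gpmf.
have B_ge0 n : 0 <= vacation_entry q pi n.
  apply: mulr_ge0 => //; apply: addr_ge0; first exact: service_end_ge0.
  by apply: mulr_ge0; [rewrite /delta|exact: vacation_end_ge0].
have f0 n : pi (Vacation n 0) = 0 by apply: piout.
have rec n u := vacation_balance n lam01 steady (g_ge0 u.+1).
have [p [beta [hp hP bal hb e]]] := flow_balance lam01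
  (fun n u => pi_ge0 (Vacation n u)) f0 gpmf gmean B_ge0 rec fin.
exists beta; split => //.
have pE n : p_vac pi n = p n.
  by apply: (sums_to_lim _ (hp n)); case.
by move=> n; rewrite pE bal (funext pE).
Qed.

(** A dormant server has at most [(qa q).-1] waiting, so dormancy can only be left by one arrival
    that makes the queue exactly [qa q]. *)
Lemma dormancy_next_above r : (qa q <= r)%N -> (0 < qa q)%N ->
  dormancy_next q pi r = (r == qa q)%:R * (lam q * pi (Dormant (qa q).-1)).
Proof.
have [_ piout _ _] := steady.
have out n : (qa q <= n)%N -> pi (Dormant n) = 0.
  by move=> an; apply: piout => /= /andP[_]; rewrite ltnNge an.
case: r => [|r] ar a0; first by move: (leq_trans a0 ar).
rewrite /dormancy_next arrS out// mulr0 add0r.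
have [re|ne] := eqVneq r.+1 (qa q); first by rewrite -re mul1r.
by rewrite mul0r out ?mulr0// -ltnS ltn_neqAle eq_sym ne.
Qed.

Hypothesis a_gt0 : (0 < qa q)%N.
Hypothesis a_le_b : (qa q <= qb q)%N.
Hypothesis serv_pmf : forall r, (qa q <= r <= qb q)%N -> is_pmf (serv q r).
Hypothesis serv_mean : forall r, (qa q <= r <= qb q)%N -> has_mean (serv q r).
Hypothesis vac_pmf : is_pmf (vac q).
Hypothesis vac_mean : has_mean (vac q).

Let ends := fun n => service_end q pi n + vacation_end q pi n.

Lemma service_endE : service_end q pi =
  arr q (fun m => \sum_(qa q <= r < (qb q).+1) pi (Busy m r 1)).
Proof.
apply/funext => n; rewrite /service_end /arr big_split /= -mulr_sumr.
by case: n => [|n]; [congr (_ + _); rewrite big1|rewrite -mulr_sumr].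
Qed.

Lemma ends_sums_to : exists LS LV,
  [/\ sums_to (service_end q pi) LS, sums_to (vacation_end q pi) LV &
      tau q pi = LS + LV].
Proof.
pose P r := limn (series (fun n => pi (Busy n r 1))).
have [_ piout _ _] := steady.
have hr r : sums_to (fun n => pi (Busy n r 1)) (P r).
  have [rab|rab] := boolP (qa q <= r <= qb q)%N.
    have [beta [[L hL] _ _ _]] := busy_flow rab (serv_pmf rab) (serv_mean rab).
    by rewrite /P (cvg_lim (@Rhausdorff R) hL).
  (* [sums_to_sum] wants convergence for every index; for an inadmissible [r] the series is
     identically zero. *)
  have hL := @sums_to_finsupp R (fun n => pi (Busy n r 1)) 0.
  have {}hL := hL (fun n _ => piout (Busy n r 1) _).
  rewrite /P; apply: cvgP; apply: hL => n /andP[rab' _].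
  by rewrite rab' in rab.
have [gamma [[LV hV] _ _ _]] := vacation_flow vac_pmf vac_mean.
have hS := sums_to_sum (s := index_iota (qa q) (qb q).+1) hr.
eexists; exists LV; split.
- by rewrite service_endE; apply: sums_to_arr; exact: hS.
- exact: sums_to_arr hV.
- by rewrite /tau; congr (_ + _); apply: cvg_lim => //.
Qed.

Lemma sums_to_ends : exists L, sums_to ends L.
Proof.
have [LS [LV [hS hV _]]] := ends_sums_to.
by exists (LS + LV); exact: sums_toD.
Qed.

(** The term [n = 0] is a queue taken whole. The terms [n > 0] occur only for [r = qb q] and run
    over the lengths above [qb q], which dormancy cannot produce. *)
Lemma busy_entry_sum r : (qa q <= r <= qb q)%N ->
  sums_to (busy_entry q pi r)
    (ends r + dormancy_next q pi r
     + (r == qb q)%:R * limn (fun n => \sum_((qb q).+1 <= i < n) ends i)).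
Proof.
move=> /andP[ar rb]; have [L hL] := sums_to_ends.
have h0 : busy_entry q pi r 0 = ends r + dormancy_next q pi r.
  by rewrite /busy_entry add0n (minn_idPl rb) eqxx mul1r.
apply/sums_to_shift; rewrite h0 addrAC subrr add0r.
apply: sums_to_ext (sums_toZ (sums_to_shiftn (k := (qb q).+1) hL)) => n.
rewrite /busy_entry /ends.
have [->|rb'] := eqVneq r (qb q).
  rewrite (minn_idPr (leq_addl _ _)) eqxx !mul1r addSnnS.
  rewrite dormancy_next_above//; last first.
    by rewrite addnS leqW// (leq_trans a_le_b)// leq_addl.
  by rewrite gtn_eqF ?mul0r ?addr0// addnS ltnS (leq_trans a_le_b)// leq_addl.
rewrite !mul0r; have -> : (r == minn (n.+1 + r) (qb q)) = false by lia.
by rewrite mul0r.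
Qed.

(** Normalization with each busy or vacation mass replaced by its entry rate times its mean
    duration. *)
Lemma mass_identity :
  1 = \sum_(0 <= n < qa q) pi (Dormant n)
    + (\sum_(qa q <= r < (qb q).+1) (ends r + dormancy_next q pi r) * s q r
       + limn (fun n => \sum_((qb q).+1 <= i < n) ends i) * s q (qb q))
    + (\sum_(0 <= n < qa q)
         (service_end q pi n + delta q * vacation_end q pi n)) * EV q.
Proof.
have [_ _ _ tot] := mass_decomposition steady.
set T := limn _.
apply: EFin_inj; rewrite [LHS]tot !EFinD; congr (_ + _ + _)%E.
- rewrite -EFinD.
  (* The overflow [T] is spread over all [r] with an indicator, to compare the two sides batch size
     by batch size. *)
  have -> : T * s q (qb q) =
      \sum_(qa q <= r < (qb q).+1) (r == qb q)%:R * T * s q r.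
    rewrite (bigD1_seq (qb q)) ?mem_index_iota ?iota_uniq ?a_le_b ?ltnSn//=.
    rewrite eqxx mul1r big1 ?addr0// => r /negbTE ->.
    by rewrite !mul0r.
  rewrite -big_split -sumEFin; apply: eq_big_nat => r rab.
  have [beta [_ _ hbeta ->]] := busy_flow rab (serv_pmf rab) (serv_mean rab).
  by rewrite (sums_to_unique hbeta (busy_entry_sum rab)) mulrDl.
- have [gamma [_ _ hgamma ->]] := vacation_flow vac_pmf vac_mean.
  congr (_ * _)%:E; apply: sums_to_unique hgamma _.
  have := @sums_to_finsupp R (vacation_entry q pi) (qa q).
  rewrite (eq_big_nat _ _ (F2 := fun n =>
    service_end q pi n + delta q * vacation_end q pi n)).
    by apply=> n an; rewrite /vacation_entry ltnNge an mul0r.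
  by move=> n /andP[_ na]; rewrite /vacation_entry na mul1r.
Qed.

End SteadyState.

(** * Epoch probabilities, dormancy and the value of [tau] *)

Lemma lim_tailZ {R : realType} (f : nat -> R) (k : nat) (c l : R) :
  sums_to f l ->
  limn (fun n => \sum_(k <= i < n) c * f i) =
  c * limn (fun n => \sum_(k <= i < n) f i).
Proof.
move=> h.
apply: sums_to_unique (sums_to_shiftn (k := k) (sums_toZ (c := c) h)) _.
exact: sums_toZ (sums_to_shiftn h).
Qed.

Section Epochs.
Context {R : realType} (q : queue R) (pi : state -> R) (p0 : nat -> R).
Hypothesis lam01 : 0 < lam q < 1.
Hypothesis steady : steady_state q pi.
Hypothesis a_gt0 : (0 < qa q)%N.
Hypothesis a_le_b : (qa q <= qb q)%N.
Hypothesis serv_pmf : forall r, (qa q <= r <= qb q)%N -> is_pmf (serv q r).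
Hypothesis serv_mean : forall r, (qa q <= r <= qb q)%N -> has_mean (serv q r).
Hypothesis vac_pmf : is_pmf (vac q).
Hypothesis vac_mean : has_mean (vac q).
Hypothesis p0_dormant : dormant_probs q pi p0.

Lemma pplusE n : pplus q pi n = (tau q pi)^-1 * service_end q pi n.
Proof. by rewrite /pplus /pplus_r -mulr_sumr. Qed.

Lemma QplusE n : Qplus q pi n = (tau q pi)^-1 * vacation_end q pi n.
Proof. by []. Qed.

(** The defining equation of [p0] reads [lam q * (p0 n - p0 n.-1) = vacation_end q pi n] for
    positive [n], and telescopes. It is valid for both vacation models. *)
Lemma dormant_balance n : (n < qa q)%N ->
  lam q * p0 n = \sum_(0 <= m < n.+1) vacation_end q pi m.
Proof.
elim: n => [|n IH] na.
  have [_] := p0_dormant na; rewrite arr0 big_nat1 /vacation_end => h.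
  by move: h; lra.
have [_] := p0_dormant na; rewrite arrS => h.
rewrite big_nat_recr//= -IH ?(ltnW na)// /vacation_end.
by move: h; lra.
Qed.

Lemma dormancy_next_sum r : (qa q <= r)%N ->
  dormancy_next q pi r =
  (r == qa q)%:R * ((1 - delta q) * \sum_(0 <= m < qa q) vacation_end q pi m).
Proof.
move=> ar; rewrite (dormancy_next_above steady)//; congr (_ * _).
have a1 : ((qa q).-1 < qa q)%N by rewrite prednK.
have [-> _] := p0_dormant a1.
by rewrite mulrCA dormant_balance// prednK.
Qed.

(** [tau] is the total rate of ends of services and vacations, all nonnegative. If it were 0,
    dormancy would vanish too by [dormant_balance], and [mass_identity] would read 1 = 0. *)
Lemma tau_neq0 : tau q pi != 0.
Proof.
apply/eqP => tau0.
have [LS [LV [hS hV tauE]]] :=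
  ends_sums_to lam01 steady serv_pmf serv_mean vac_pmf vac_mean.
have S_ge0 := service_end_ge0 lam01 steady.
have V_ge0 := vacation_end_ge0 lam01 steady.
have LS0 := sums_to_ge0 S_ge0 hS.
have LV0 := sums_to_ge0 V_ge0 hV.
have LSE : LS = 0 by lra.
have LVE : LV = 0 by lra.
rewrite LSE in hS; rewrite LVE in hV.
have S0 n : service_end q pi n = 0 by apply: sums_to_eq0 hS.
have V0 n : vacation_end q pi n = 0 by apply: sums_to_eq0 hV.
have sV0 : \sum_(0 <= m < qa q) vacation_end q pi m = 0 by rewrite big1.
have D0 n : (n < qa q)%N -> pi (Dormant n) = 0.
  move=> na; have [-> _] := p0_dormant na.
  have := dormant_balance na; rewrite big1// => /eqP.
  have /andP[l0 _] := lam01.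
  by rewrite mulf_eq0 gt_eqF//= => /eqP ->; rewrite mulr0.
have := mass_identity lam01 steady a_gt0 a_le_b serv_pmf serv_mean
  vac_pmf vac_mean.
rewrite big_nat_cond big1 => [|n /andP[/andP[_ na] _]]; last exact: D0.
rewrite big_nat_cond big1 => [|n /andP[/andP[na _] _]]; last first.
  rewrite S0 V0 (dormancy_next_sum na).
  by rewrite sV0 !mulr0 !addr0 mul0r.
rewrite [X in _ + _ + X * EV q]big1 => [|n _]; last first.
  by rewrite S0 V0 mulr0 addr0.
rewrite (_ : (fun n => _) = fun=> 0).
  by rewrite lim_cst// !mul0r !addr0 => /eqP; rewrite oner_eq0.
by apply/funext => n; rewrite big1// => i _; rewrite S0 V0 addr0.
Qed.

Lemma service_end_pplus n : service_end q pi n = tau q pi * pplus q pi n.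
Proof. by rewrite pplusE mulVKf// tau_neq0. Qed.

Lemma vacation_end_Qplus n : vacation_end q pi n = tau q pi * Qplus q pi n.
Proof. by rewrite QplusE mulVKf// tau_neq0. Qed.

(** This is [mass_identity] multiplied by [lam q]: dormancy yields the double sum of [Estar], the
    remaining terms yield [lam q * omega q pi], each with a factor [tau]. *)
Lemma tau_Estar : tau q pi * Estar q pi = lam q.
Proof.
have t0 := tau_neq0.
have [L hL] := sums_to_ends lam01 steady serv_pmf serv_mean vac_pmf vac_mean.
have := mass_identity lam01 steady a_gt0 a_le_b serv_pmf serv_mean
  vac_pmf vac_mean.
set T := limn _ => mass.
have tail : limn (fun n => \sum_((qb q).+1 <= i < n)
    (pplus q pi i + Qplus q pi i) * s q (qb q)) =
    (tau q pi)^-1 * s q (qb q) * T.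
  rewrite /T -(lim_tailZ _ _ hL); congr (limn _).
  apply/funext => n; apply: eq_bigr => i _.
  by rewrite pplusE QplusE; ring.
rewrite -[RHS]mulr1 mass /Estar /omega tail.
have dormants : lam q * \sum_(0 <= n < qa q) pi (Dormant n) =
    tau q pi * ((1 - delta q) *
      \sum_(0 <= i < qa q) \sum_(0 <= m < i.+1) Qplus q pi m).
  rewrite mulrCA !mulr_sumr; apply: eq_big_nat => n /andP[_ na].
  have [-> _] := p0_dormant na.
  under [in RHS]eq_bigr do rewrite QplusE.
  by rewrite -mulr_sumr -dormant_balance//; field.
(* Services started from dormancy all have size [qa q]. Their term is split off here and absorbed by
   [short], since [omega] books it under the lengths below [qa q]. *)
have batches : \sum_(qa q <= r < (qb q).+1)
      (service_end q pi r + vacation_end q pi r + dormancy_next q pi r)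
      * s q r =
    tau q pi * (\sum_(qa q <= n < (qb q).+1)
      (pplus q pi n + Qplus q pi n) * s q n) +
    (1 - delta q) * (\sum_(0 <= n < qa q) vacation_end q pi n) * s q (qa q).
  have -> : (1 - delta q) * (\sum_(0 <= n < qa q) vacation_end q pi n)
      * s q (qa q)
     = \sum_(qa q <= r < (qb q).+1) dormancy_next q pi r * s q r.
    rewrite [RHS]big_ltn ?ltnS// dormancy_next_sum// eqxx mul1r.
    rewrite [X in _ = _ + X]big_nat_cond [X in _ = _ + X]big1 ?addr0//.
    move=> r /andP[/andP[ar _] _].
    by rewrite dormancy_next_sum 1?ltnW// gtn_eqF// !mul0r.
  rewrite mulr_sumr -big_split; apply: eq_bigr => r _ /=.
  by rewrite service_end_pplus vacation_end_Qplus; ring.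
have short : (\sum_(0 <= n < qa q)
      (service_end q pi n + delta q * vacation_end q pi n)) * EV q +
    (1 - delta q) * (\sum_(0 <= n < qa q) vacation_end q pi n) * s q (qa q) =
    tau q pi * \sum_(0 <= n < qa q)
     (pplus q pi n * EV q + (1 - delta q) * Qplus q pi n * s q (qa q)
      + delta q * Qplus q pi n * EV q).
  rewrite [RHS]mulr_sumr [X in X + _]mulr_suml.
  rewrite [X in X * s q _]mulr_sumr [X in _ + X]mulr_suml -big_split.
  apply: eq_bigr => n _ /=.
  by rewrite service_end_pplus vacation_end_Qplus; ring.
rewrite !mulrDr dormants batches; move: short; rewrite -/T.
move: (\sum_(0 <= n < qa q) (_ + _ * _ + _)) (\sum_(qa q <= n < _) _)
  (\sum_(0 <= i < qa q) \sum_(0 <= m < i.+1) _) => x y z short.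
have -> : lam q * ((\sum_(0 <= n < qa q)
   (service_end q pi n + delta q * vacation_end q pi n)) * EV q) =
   lam q * (tau q pi * x) - lam q * ((1 - delta q) *
    (\sum_(0 <= n < qa q) vacation_end q pi n) * s q (qa q)).
  by rewrite -short; ring.
by field.
Qed.

End Epochs.

(** * Solving the balance equations slot by slot *)

Theorem theorem6p1 (R : realType) (q : queue R)
  (a_ge1 : (1 <= qa q)%N) (a_le_b : (qa q <= qb q)%N)
  (lam_gt0 : 0 < lam q) (lam_lt1 : lam q < 1)
  (serv_pmf : forall r, (qa q <= r <= qb q)%N -> is_pmf (serv q r))
  (serv_mean : forall r, (qa q <= r <= qb q)%N -> has_mean (serv q r))
  (vac_pmf : is_pmf (vac q)) (vac_mean : has_mean (vac q))
  (stable : lam q / ((qb q)%:R * mu q (qb q)) < 1)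
  (pi : state -> R) (pi_steady : steady_state q pi)
  (p0 : nat -> R) (p0_dormant : dormant_probs q pi p0) :
  let a := qa q in
  let b := qb q in
  let d := delta q in
  let E := Estar q pi in
  let p := p_busy pi in
  let Q := p_vac pi in
  let ppr := pplus_r q pi in
  let pp := pplus q pi in
  let Qp := Qplus q pi in
  (forall n, (n <= a.-1)%N -> p0 n = E^-1 * \sum_(0 <= m < n.+1) Qp m) /\
  p 0%N a = E^-1 * (pp a + Qp a - ppr 0%N a
                  + (1 - d) * \sum_(0 <= m < a) Qp m) /\
  (forall r, (a.+1 <= r <= b)%N -> p 0%N r = E^-1 * (pp r + Qp r - ppr 0%N r)) /\
  (forall n r, (1 <= n)%N -> (a <= r <= b.-1)%N ->
     p n r = p n.-1 r - ppr n r / E) /\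
  (forall n, (1 <= n)%N ->
     p n b = p n.-1 b + E^-1 * (pp (n + b)%N + Qp (n + b)%N - ppr n b)) /\
  Q 0%N = E^-1 * (pp 0%N - (1 - d) * Qp 0%N) /\
  (forall n, (1 <= n <= a.-1)%N ->
     Q n = Q n.-1 + E^-1 * (pp n - (1 - d) * Qp n)) /\
  (forall n, (a <= n)%N -> Q n = Q n.-1 - Qp n / E).
Proof.
move=> a b d E p Q ppr pp Qp.
have lam01 : 0 < lam q < 1 by rewrite lam_gt0.
have t0 := tau_neq0 lam01 pi_steady a_ge1 a_le_b serv_pmf serv_mean
  vac_pmf vac_mean p0_dormant.
have tE := tau_Estar lam01 pi_steady a_ge1 a_le_b serv_pmf serv_mean
  vac_pmf vac_mean p0_dormant.
have l0 : lam q != 0 by rewrite gt_eqF.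
have EE : E^-1 = tau q pi / lam q.
  by rewrite -tE invfM mulrA mulfV// mul1r.
have eS n : service_end q pi n = tau q pi * pp n :=
  service_end_pplus lam01 pi_steady a_ge1 a_le_b serv_pmf serv_mean
  vac_pmf vac_mean p0_dormant n.
have eV n : vacation_end q pi n = tau q pi * Qp n :=
  vacation_end_Qplus lam01 pi_steady a_ge1 a_le_b serv_pmf serv_mean
  vac_pmf vac_mean p0_dormant n.
have eD := dormancy_next_sum pi_steady a_ge1 p0_dormant.
have sV n : \sum_(0 <= m < n) vacation_end q pi m
    = tau q pi * \sum_(0 <= m < n) Qp m.
  by rewrite mulr_sumr; apply: eq_bigr => m _; exact: eV.
have eR n r : arr q (fun m => pi (Busy m r 1)) n = tau q pi * ppr n r.
  by rewrite /ppr /pplus_r mulVKf.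
have eW n : arr q (fun m => pi (Vacation m 1)) n = tau q pi * Qp n by exact: eV.
have busy r (rab : (qa q <= r <= qb q)%N) n : p n r = arr q (p ^~ r) n
    - tau q pi * ppr n r + busy_entry q pi r n.
  have [beta [_ h _ _]] := busy_flow lam01 pi_steady rab (serv_pmf r rab)
    (serv_mean r rab).
  by rewrite -eR; exact: h.
have vacn n : Q n = arr q Q n - tau q pi * Qp n + vacation_entry q pi n.
  have [gamma [_ h _ _]] := vacation_flow lam01 pi_steady vac_pmf vac_mean.
  by rewrite -eW; exact: h.
(* [A] is the outflow and [B] the inflow in units of [tau]. At length 0 the equation is
   [lam q * x = tau * (B - A)], and [tau / lam q] is [E^-1]; [solveS] adds the neighbour [y]. *)
have solve0 (x A B : R) : x = (1 - lam q) * x - tau q pi * A + tau q pi * B ->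
    x = E^-1 * (B - A).
  move=> h; rewrite EE; apply: (mulfI l0).
  have -> : lam q * (tau q pi / lam q * (B - A)) = tau q pi * (B - A) by field.
  by move: h; lra.
have solveS (x y A B : R) : x = (1 - lam q) * x + lam q * y - tau q pi * A
    + tau q pi * B -> x = y + E^-1 * (B - A).
  move=> h; rewrite EE; apply: (mulfI l0).
  have -> : lam q * (y + tau q pi / lam q * (B - A)) =
    lam q * y + tau q pi * (B - A) by field.
  by move: h; lra.
have entry0 r : (qa q <= r <= qb q)%N -> busy_entry q pi r 0 =
    tau q pi * (pp r + Qp r + (r == qa q)%:R *
      ((1 - d) * \sum_(0 <= m < a) Qp m)).
  move=> /andP[ar rb]; rewrite /busy_entry add0n (minn_idPl rb) eqxx mul1r.
  by rewrite eS eV eD// sV -/d -/a; ring.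
split => [n na|].
  have {}na : (n < qa q)%N by rewrite -(prednK a_ge1) ltnS.
  rewrite EE; apply: (mulfI l0); rewrite (dormant_balance p0_dormant na) sV.
  by field.
split.
  have rab : (qa q <= a <= qb q)%N by rewrite leqnn.
  have := busy a rab 0%N; rewrite arr0 entry0// eqxx mul1r => /solve0 ->.
  by congr (_ * _); ring.
split => [r /andP[ar rb]|].
  have rab : (qa q <= r <= qb q)%N by rewrite ltnW.
  have := busy r rab 0%N; rewrite arr0 entry0// gtn_eqF// mul0r addr0.
  by move=> /solve0.
split => [[//|n] r _ /andP[ar rb]|].
  have rb' : (r < qb q)%N by rewrite -(prednK (leq_trans a_ge1 a_le_b)) ltnS.
  have rab : (qa q <= r <= qb q)%N by rewrite ar ltnW.
  have := busy r rab n.+1; rewrite arrS.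
  (* A batch below [qb q] leaves nobody behind, so there is no inflow; the product form fits
     [solveS] with [B = 0]. *)
  have -> : busy_entry q pi r n.+1 = tau q pi * 0.
    rewrite /busy_entry (_ : (r == _) = false) ?mul0r ?mulr0//.
    by apply/eqP; lia.
  by move=> /solveS ->; rewrite /=; ring.
split => [[//|n] _|].
  have rab : (qa q <= b <= qb q)%N by rewrite a_le_b /=.
  have := busy b rab n.+1; rewrite arrS.
  have -> : busy_entry q pi b n.+1 =
      tau q pi * (pp (n.+1 + b)%N + Qp (n.+1 + b)%N).
    have ab : (qa q < n.+1 + b)%N.
      by rewrite addSn ltnS (leq_trans a_le_b)// leq_addl.
    rewrite /busy_entry (minn_idPr (leq_addl _ _)) eqxx mul1r eS eV.
    by rewrite eD 1?ltnW// gtn_eqF// mul0r addr0 mulrDr.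
  by move=> /solveS ->.
split.
  have := vacn 0%N; rewrite arr0 /vacation_entry a_ge1 mul1r eS eV.
  (* The inflow carries [d * Qp] and the outflow [Qp]; their difference is the asserted
     [- (1 - d) * Qp]. *)
  rewrite (_ : _ + _ * _ = tau q pi * (pp 0%N + d * Qp 0%N));
    last by rewrite /d; ring.
  by move=> /solve0 ->; congr (_ * _); ring.
split => [[//|n] /andP[_ na]|[|n] an].
- have {}na : (n.+1 < qa q)%N by rewrite -(prednK a_ge1) ltnS.
  have := vacn n.+1; rewrite arrS /vacation_entry na mul1r eS eV.
  rewrite (_ : _ + delta q * _ = tau q pi * (pp n.+1 + d * Qp n.+1));
    last by rewrite /d; ring.
  by move=> /solveS ->; rewrite /=; ring.
(* Length 0, where [n.-1] would be 0 again, is excluded by [1 <= qa q]. *)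
- by move: (leq_trans a_ge1 an).
- have := vacn n.+1; rewrite arrS /vacation_entry ltnNge an mul0r.
  rewrite -[0](mulr0 (tau q pi)) => /solveS ->; rewrite /=; ring.
Qed.
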